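(* The modal logic $\Gamma(\mathbf{LV},\omega,1)$ has the uniform Lyndon interpolation property.
   Context: Modal formulas use variables, $\bot,\land,\lor,\neg,\to,\Box$. Positive/negative variables: $v^+(p)=\{p\}$, $v^-(p)=\emptyset$, $v^\circ(\bot)=\emptyset$, $\land,\lor,\Box$ preserve polarity, $v^\pm(\neg\varphi)=v^\mp(\varphi)$, $v^+(\varphi\to\psi)=v^-(\varphi)\cup v^+(\psi)$, $v^-(\varphi\to\psi)=v^+(\varphi)\cup v^-(\psi)$. $\Gamma(\mathbf{LV},\omega,1)$ is the set of modal formulas true at every world of every Kripke model on every finite frame of the following form: $W=\{r\}\cup C^0\cup C^1$ where $C^0,C^1$ are disjoint finite nonempty sets not containing $r$, and $R$ is reflexive, $rRx$ for all $x$, $xRy$ for all $x,y\in C^k$ ($k=0,1$), and no other pairs (a root below two distinct finite final clusters). A logic $L$ has the uniform Lyndon interpolation property iff for every formula $\varphi$ and finite sets $P^+,P^-$ of variables there is $\theta$ with $L\vdash\varphi\to\theta$, $v^\circ(\theta)\subseteq v^\circ(\varphi)\setminus P^\circ$ for $\circ\in\{+,-\}$, and $L\vdash\theta\to\psi$ for every $\psi$ with $L\vdash\varphi\to\psi$ and $v^\circ(\psi)\cap P^\circ=\emptyset$ for $\circ\in\{+,-\}$. *)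

(* Defs.v *)
From mathcomp Require Import all_boot finmap.

Set Implicit Arguments.
Unset Strict Implicit.
Unset Printing Implicit Defensive.

Local Open Scope fset_scope.

Inductive form : Type :=
| Var of nat
| Bot
| And of form & form
| Or of form & form
| Neg of form
| Imp of form & form
| Box of form.

(* [vars true] and [vars false] are the sets v^+ and v^- of variables occurring
   positively and negatively. *)
Fixpoint vars (s : bool) (phi : form) : {fset nat} :=
  match phi with
  | Var p => if s then [fset p] else fset0
  | Bot => fset0
  | And a b | Or a b => vars s a `|` vars s b
  | Neg a => vars (~~ s) a
  | Imp a b => vars (~~ s) a `|` vars s b
  | Box a => vars s a
  end.

Notation vpos := (vars true).
Notation vneg := (vars false).

Fixpoint sat (W : finType) (R : rel W) (V : nat -> pred W) (x : W)
    (phi : form) : bool :=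
  match phi with
  | Var p => V p x
  | Bot => false
  | And a b => sat R V x a && sat R V x b
  | Or a b => sat R V x a || sat R V x b
  | Neg a => ~~ sat R V x a
  | Imp a b => sat R V x a ==> sat R V x b
  | Box a => [forall y, R x y ==> sat R V y a]
  end.

Definition valid_on (W : finType) (R : rel W) (phi : form) : Prop :=
  forall (V : nat -> pred W) (x : W), sat R V x phi.

Record root_two_clusters (W : finType) (R : rel W) (r : W) (C0 C1 : {set W}) :
    Prop := RootTwoClusters {
  cluster0_neq0 : C0 != set0;
  cluster1_neq0 : C1 != set0;
  clusters_disjoint : C0 :&: C1 = set0;
  root_notin0 : r \notin C0;
  root_notin1 : r \notin C1;
  worldsE : [set: W] = r |: (C0 :|: C1);
  accE : forall x y, R x y = [|| x == y, x == r,
                                 (x \in C0) && (y \in C0)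
                               | (x \in C1) && (y \in C1)]
}.

Definition LV_frame (W : finType) (R : rel W) : Prop :=
  exists (r : W) (C0 C1 : {set W}), root_two_clusters R r C0 C1.

(* A logic is identified with its set of theorems: [L phi] reads L |- phi. *)
Definition logic := form -> Prop.

(* Gamma(LV, omega, 1) *)
Definition Gamma_LV_omega_1 : logic :=
  fun phi => forall (W : finType) (R : rel W), LV_frame R -> valid_on R phi.

Definition uniform_Lyndon_interpolation (L : logic) : Prop :=
  forall (phi : form) (Ppos Pneg : {fset nat}),
  exists theta : form,
    [/\ L (Imp phi theta),
        vpos theta `<=` vpos phi `\` Ppos,
        vneg theta `<=` vneg phi `\` Pneg
      & forall psi : form,
          L (Imp phi psi) ->
          vpos psi `&` Ppos = fset0 ->
          vneg psi `&` Pneg = fset0 ->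
          L (Imp theta psi)].

(* Main.v *)
From mathcomp Require Import all_boot finmap boolp.
Require Import Defs.

Set Implicit Arguments.
Unset Strict Implicit.
Unset Printing Implicit Defensive.

Local Open Scope fset_scope.

(** Fix the finite sets X+ and X- of variables that the interpolant may use.  Up
    to p-morphism a pointed model is a root above which lie two clusters, so what
    formulas over X+, X- can say about it is captured by a finite datum: the set
    of literals true at the root and, for each cluster, the set of literal types
    realized in it.  Each datum has a characteristic formula, and the interpolant
    is the disjunction of the characteristic formulas of the models of phi.  If
    it holds at y, some model (M, x) of phi has its two clusters matched with
    those seen from y by a total and surjective relation; on two-element sets
    such a relation contains a bijection, so the clusters can be paired off and
    the fibre products of the pairs, below the new root (x, y), form a model of
    the right shape which satisfies phi and refutes every psi that fails at y. *)

(** * Finite conjunctions and disjunctions *)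

Definition Dia (a : form) : form := Neg (Box (Neg a)).

Section FiniteConnectives.
Variable T : finType.
Implicit Types (A : {set T}) (F : T -> form).

Definition bigAnd A F : form :=
  foldr (fun t => And (F t)) (Neg Bot) (enum A).

Definition bigOr A F : form := foldr (fun t => Or (F t)) Bot (enum A).

Lemma vars_bigAnd s A F X :
  (forall t, vars s (F t) `<=` X) -> vars s (bigAnd A F) `<=` X.
Proof.
move=> FX; rewrite /bigAnd; elim: (enum A) => [|t e IH] /=; first exact: fsub0set.
by rewrite fsubUset FX.
Qed.

Lemma vars_bigOr s A F X :
  (forall t, vars s (F t) `<=` X) -> vars s (bigOr A F) `<=` X.
Proof.
move=> FX; rewrite /bigOr; elim: (enum A) => [|t e IH] /=; first exact: fsub0set.
by rewrite fsubUset FX.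
Qed.

Variables (W : finType) (R : rel W) (V : nat -> pred W) (x : W).

Lemma sat_bigAnd A F :
  reflect (forall t, t \in A -> sat R V x (F t)) (sat R V x (bigAnd A F)).
Proof.
suff -> : sat R V x (bigAnd A F) = all (fun t => sat R V x (F t)) (enum A).
  by apply: (iffP allP) => H t tA; apply: H; rewrite mem_enum in tA *.
by rewrite /bigAnd; elim: (enum A) => //= t e ->.
Qed.

Lemma sat_bigOr A F :
  reflect (exists2 t, t \in A & sat R V x (F t)) (sat R V x (bigOr A F)).
Proof.
suff -> : sat R V x (bigOr A F) = has (fun t => sat R V x (F t)) (enum A).
  by apply: (iffP hasP) => -[t tA Ft]; exists t; rewrite ?mem_enum in tA *.
by rewrite /bigOr; elim: (enum A) => //= t e ->.
Qed.

End FiniteConnectives.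

Lemma sat_And (W : finType) (R : rel W) V x a b :
  sat R V x (And a b) = sat R V x a && sat R V x b.
Proof. by []. Qed.

Lemma sat_Box (W : finType) (R : rel W) V x a :
  reflect (forall y, R x y -> sat R V y a) (sat R V x (Box a)).
Proof. exact: 'forall_implyP. Qed.

Lemma sat_Dia (W : finType) (R : rel W) V x a :
  reflect (exists2 y, R x y & sat R V y a) (sat R V x (Dia a)).
Proof.
rewrite /= negb_forall; apply: (iffP existsP) => -[y].
  by rewrite negb_imply negbK => /andP[]; exists y.
by move=> xy ya; exists y; rewrite xy ya.
Qed.

(** * Shape of the submodel generated by a point *)

(* The two sets may coincide, which is what happens when [x] lies in a cluster. *)
Record sees_clusters (W : finType) (R : rel W) (x : W) (A : bool -> {set W}) :
    Prop := SeesClusters {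
  seen_neq0 : forall i, A i != set0;
  seen_fromE : forall y, R x y = (y == x) || [exists i, y \in A i];
  seen_clusterE : forall i y z, y \in A i -> R y z = (z \in A i)
}.

Lemma LV_frame_sees_clusters (W : finType) (R : rel W) (x : W) :
  LV_frame R -> exists A, sees_clusters R x A.
Proof.
case=> r [C0] [C1] [C0n C1n C01 rC0 rC1 WE RE].
have inW y : [|| y == r, y \in C0 | y \in C1].
  by have := in_setT y; rewrite WE !inE.
have C01F y : y \in C0 -> y \in C1 -> False.
  by move=> y0 y1; have := in_set0 y; rewrite -C01 inE y0 y1.
have R0 y z : y \in C0 -> R y z = (z \in C0).
  move=> y0; rewrite RE y0 /=; case: (y =P z) => [<-|_]; first by rewrite y0.
  case: (y =P r) => [yr|_]; first by rewrite -yr y0 in rC0.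
  by case: (boolP (y \in C1)) => [/(C01F _ y0)//|_]; rewrite /= orbF.
have R1 y z : y \in C1 -> R y z = (z \in C1).
  move=> y1; rewrite RE y1 /=; case: (y =P z) => [<-|_]; first by rewrite y1.
  case: (y =P r) => [yr|_]; first by rewrite -yr y1 in rC1.
  by case: (boolP (y \in C0)) => [/C01F/(_ y1)//|_].
have ex2 (P : pred bool) : [exists i, P i] = P false || P true.
  by apply/existsP/orP => [[[]]|[]]; [right | left | exists false | exists true].
case/or3P: (inW x) => [/eqP->|x0|x1].
- exists (fun i => if i then C1 else C0); split=> [[]//|y|[] y z]; last 2 first.
  + exact: R1.
  + exact: R0.
  by rewrite ex2 RE eqxx orbT inW.
- exists (fun=> C0); split=> [//|y|_ y z]; last exact: R0.
  by rewrite ex2 orbb R0//; case: eqP => [->|].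
- exists (fun=> C1); split=> [//|y|_ y z]; last exact: R1.
  by rewrite ex2 orbb R1//; case: eqP => [->|].
Qed.

(** Used to straighten a crossed matching of clusters by relabelling. *)
Lemma sees_clusters_swap (W : finType) (R : rel W) x A :
  sees_clusters R x A -> sees_clusters R x (A \o negb).
Proof.
case=> An xE AE; split=> [i|y|i y z]; [exact: An| |exact: AE].
rewrite xE; congr orb.
by apply/existsP/existsP => -[i yi]; exists (~~ i); rewrite /= ?negbK.
Qed.

Lemma sees_clusters_refl (W : finType) (R : rel W) x A :
  sees_clusters R x A -> R x x.
Proof. by case=> _ xE _; rewrite xE eqxx. Qed.

Lemma sees_clusters_mem (W : finType) (R : rel W) x A i y :
  sees_clusters R x A -> y \in A i -> R x y.
Proof. by case=> _ xE _ yi; rewrite xE; apply/orP; right; apply/existsP; exists i. Qed.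

(** * Frames with two prescribed clusters and their p-morphisms *)

Section TwoClusterFrame.
Variable E : bool -> finType.

(** [None] is the root. The tags keep the clusters disjoint even when both are sent to the same
    cluster of [W]. *)
Definition two_cluster_rel (u v : option {i : bool & E i}) : bool :=
  match u, v with
  | None, _ => true
  | Some a, Some b => tag a == tag b
  | Some _, None => false
  end.

Lemma two_cluster_LV_frame : (forall i, inhabited (E i)) -> LV_frame two_cluster_rel.
Proof.
move=> Ei; pose C i := [set u : option {i : bool & E i} | omap tag u == Some i].
have Cn i : C i != set0.
  by case: (Ei i) => e; apply/set0Pn; exists (Some (Tagged E e)); rewrite inE.
exists None, (C false), (C true); split=> //; rewrite ?inE //.
- by apply/setP => -[[[] e]|]; rewrite !inE.
- by apply/setP => -[[[] e]|]; rewrite !inE.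
move=> [[i e]|] [[j f]|]; rewrite !inE //= ?orbT ?andbF //.
case: (i =P j) => [ij|/eqP ij]; first by subst j; case: i e f => e f; rewrite orbT.
have /negPf-> : Some (existT (fun i => E i) i e) != Some (existT (fun i => E i) j f).
  by apply: contra_neq ij => -[].
by move: ij {e f}; case: i j => [] [].
Qed.

Variables (W : finType) (f : forall i, E i -> W) (x : W).

Definition two_cluster_map (u : option {i : bool & E i}) : W :=
  if u is Some a then f (tagged a) else x.

Variables (R : rel W) (A : bool -> {set W}).
Hypotheses (xA : sees_clusters R x A) (fA : forall i (e : E i), f e \in A i)
  (Af : forall i w, w \in A i -> exists e : E i, f e = w).

Lemma two_cluster_map_homo u v :
  two_cluster_rel u v -> R (two_cluster_map u) (two_cluster_map v).
Proof.
case: u v => [[i e]|] [[j e']|] //= => [/eqP ij|_|_].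
- by subst j; rewrite (seen_clusterE xA _ (fA e)).
- exact: (sees_clusters_mem xA (fA e')).
- exact: sees_clusters_refl xA.
Qed.

Lemma two_cluster_map_lift u w :
  R (two_cluster_map u) w -> exists2 v, two_cluster_rel u v & two_cluster_map v = w.
Proof.
case: u => [[i e]|] /=.
  rewrite (seen_clusterE xA _ (fA e)) => /Af[e' <-].
  by exists (Some (Tagged E e')) => /=.
rewrite (seen_fromE xA) => /orP[/eqP->|/existsP[i /Af[e <-]]].
  by exists None.
by exists (Some (Tagged E e)).
Qed.

End TwoClusterFrame.

(** * Polarized p-morphism lemma *)

(** Both implications go through one induction, because negation and the antecedent of an
    implication exchange them. *)
Lemma pmorphism_sat (K W : finType) (S : rel K) (R : rel W) (U : nat -> pred K)
    (V : nat -> pred W) (f : K -> W) (X Y : {fset nat}) :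
  (forall u v, S u v -> R (f u) (f v)) ->
  (forall u w, R (f u) w -> exists2 v, S u v & f v = w) ->
  (forall u p, p \in X -> V p (f u) -> U p u) ->
  (forall u p, p \in Y -> U p u -> V p (f u)) ->
  forall a u,
    (vpos a `<=` X -> vneg a `<=` Y -> sat R V (f u) a -> sat S U u a) /\
    (vneg a `<=` X -> vpos a `<=` Y -> sat S U u a -> sat R V (f u) a).
Proof.
move=> homo_f lift_f VU UV; elim=> [p||a IHa b IHb|a IHa b IHb|a IHa|a IHa b IHb|a IHa] u.
- by rewrite /= !fsub1set; split=> [pX _|_ pY]; [exact: VU | exact: UV].
- by [].
- have [[a1 a2] [b1 b2]] := (IHa u, IHb u); rewrite /= !fsubUset.
  split=> /andP[aX bX] /andP[aY bY] /andP[sa sb]; apply/andP; split; auto.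
- have [[a1 a2] [b1 b2]] := (IHa u, IHb u); rewrite /= !fsubUset.
  by split=> /andP[aX bX] /andP[aY bY] /orP[sa|sb]; apply/orP;
    [left|right|left|right]; auto.
- have [a1 a2] := IHa u.
  by split=> /= aX aY; apply: contra; auto.
- have [[a1 a2] [b1 b2]] := (IHa u, IHb u); rewrite /= !fsubUset.
  by split=> /andP[aX bX] /andP[aY bY] /implyP sab; apply/implyP => sa; auto.
- split=> aX aY /sat_Box H; apply/sat_Box.
    by move=> v uv; apply: (proj1 (IHa v)) => //; apply: H; exact: homo_f.
  by move=> w /lift_f[v uv <-]; apply: (proj2 (IHa v)) => //; exact: H.
Qed.

(** * Characteristic formulas *)

Section Characteristic.
Variables Xpos Xneg : {fset nat}.

Definition literal : finType := (Xpos + Xneg)%type.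

Definition lit (l : literal) : form :=
  match l with inl p => Var (val p) | inr p => Neg (Var (val p)) end.

(** The failure of literals outside [t] is not asserted, as that would use variables in the opposite
    polarity; so truth means inclusion of types, not equality. *)
Definition type_formula (t : {set literal}) : form := bigAnd t lit.

(** The cover modality of the types in [T]. The box before each diamond changes nothing inside a
    cluster, and makes truth at a root persist to the clusters above. *)
Definition cluster_formula (T : {set {set literal}}) : form :=
  And (Box (bigOr T type_formula)) (bigAnd T (fun t => Box (Dia (type_formula t)))).

Definition datum : finType :=
  ({set literal} * {ffun bool -> {set {set literal}}})%type.

(** The cover modality over the two clusters. Under the box the cluster formulas carry a diamond,
    since the box also ranges over the root, where they may fail. *)
Definition char_formula (d : datum) : form :=
  And (type_formula d.1)
    (And (bigAnd setT (fun i => Dia (cluster_formula (d.2 i))))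
         (Box (bigOr setT (fun i => Dia (cluster_formula (d.2 i)))))).

Definition lvars (s : bool) : {fset nat} := if s then Xpos else Xneg.

Lemma vars_type_formula s t : vars s (type_formula t) `<=` lvars s.
Proof.
apply: vars_bigAnd => -[] p; case: s => /=; rewrite ?fsub0set //;
  by rewrite fsub1set; exact: valP.
Qed.

Lemma vars_cluster_formula s T : vars s (cluster_formula T) `<=` lvars s.
Proof.
rewrite /= fsubUset vars_bigOr ?vars_bigAnd //= => t; last exact: vars_type_formula.
by rewrite negbK vars_type_formula.
Qed.

Lemma vars_char_formula s d : vars s (char_formula d) `<=` lvars s.
Proof.
have H i : vars s (Dia (cluster_formula (d.2 i))) `<=` lvars s.
  by rewrite [vars _ _]/= negbK; exact: vars_cluster_formula.
rewrite [vars _ _]/= !fsubUset vars_type_formula.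
by rewrite vars_bigAnd // vars_bigOr.
Qed.

Section Model.
Variables (W : finType) (R : rel W) (V : nat -> pred W).

Definition ltype (x : W) : {set literal} := [set l | sat R V x (lit l)].

Lemma sat_type_formula x t : sat R V x (type_formula t) = (t \subset ltype x).
Proof.
by apply/sat_bigAnd/subsetP => H l /H; rewrite inE.
Qed.

(* The Egli-Milner lifting of inclusion of literal types. *)
Definition matches (T : {set {set literal}}) (B : {set W}) : Prop :=
  (forall b, b \in B -> exists2 t, t \in T & t \subset ltype b) /\
  (forall t, t \in T -> exists2 b, b \in B & t \subset ltype b).

Lemma sat_cluster_formula T (B : {set W}) b :
  b \in B -> (forall y z, y \in B -> R y z = (z \in B)) ->
  sat R V b (cluster_formula T) <-> matches T B.
Proof.
move=> bB RB; split=> [/andP[/sat_Box H1 /sat_bigAnd H2]|[H1 H2]].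
  split=> [c cB|t tT].
    have /H1/sat_bigOr[t tT] : R b c by rewrite RB.
    by rewrite sat_type_formula; exists t.
  have /sat_Box/(_ b) := H2 t tT; rewrite RB // => /(_ bB)/sat_Dia[c].
  by rewrite RB // sat_type_formula; exists c.
apply/andP; split.
  apply/sat_Box => c; rewrite RB // => /H1[t tT tc].
  by apply/sat_bigOr; exists t => //; rewrite sat_type_formula.
apply/sat_bigAnd => t /H2[c cB tc]; apply/sat_Box => y; rewrite RB // => yB.
by apply/sat_Dia; exists c; rewrite ?RB // sat_type_formula.
Qed.

Variables (x : W) (A : bool -> {set W}).
Hypothesis xA : sees_clusters R x A.

Definition datum_of : datum := (ltype x, [ffun i => ltype @: A i]).

Lemma matches_self (B : {set W}) : matches (ltype @: B) B.
Proof.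
by split=> [b bB|_ /imsetP[b bB ->]]; [exists (ltype b); first exact: imset_f | exists b].
Qed.

Lemma sat_Dia_cluster_formula i b T :
  b \in A i -> sat R V b (Dia (cluster_formula T)) <-> matches T (A i).
Proof.
move=> bA; have RA := seen_clusterE xA; split.
  by case/sat_Dia=> c; rewrite (RA i) // => /sat_cluster_formula H /H-/(_ (RA i)).
move=> m; apply/sat_Dia; exists b; first by rewrite (RA i).
by apply/(sat_cluster_formula T bA (RA i)).
Qed.

Lemma sat_root_Dia_cluster_formula T :
  sat R V x (Dia (cluster_formula T)) -> exists i, matches T (A i).
Proof.
case/sat_Dia=> y; rewrite (seen_fromE xA) => /orP[/eqP->|/existsP[i yi]] H; last first.
  by exists i; apply/(sat_cluster_formula T yi (seen_clusterE xA (i:=i))).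
have /set0Pn[b bA] := seen_neq0 xA true.
have xb := sees_clusters_mem xA bA.
exists true; apply/(sat_cluster_formula T bA (seen_clusterE xA (i:=true))).
(* Everything in a cluster formula is boxed, so it persists upwards. *)
move: H => /andP[/sat_Box H1 /sat_bigAnd H2].
have up c : R b c -> R x c.
  by rewrite (seen_clusterE xA _ bA) => /(sees_clusters_mem xA).
apply/andP; split; first by apply/sat_Box => c /up/H1.
by apply/sat_bigAnd => t /H2/sat_Box H; apply/sat_Box => c /up/H.
Qed.

Lemma sat_char_formula_of : sat R V x (char_formula datum_of).
Proof.
have self i b : b \in A i -> sat R V b (Dia (cluster_formula (datum_of.2 i))).
  move=> bA; apply/(sat_Dia_cluster_formula _ bA); rewrite ffunE.
  exact: matches_self.
have root i : sat R V x (Dia (cluster_formula (datum_of.2 i))).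
  have /set0Pn[b bA] := seen_neq0 xA i.
  have /sat_Dia[c bc H] := self i b bA; apply/sat_Dia; exists c => //.
  by move: bc; rewrite (seen_clusterE xA _ bA) => /(sees_clusters_mem xA).
rewrite sat_And sat_type_formula subxx andTb sat_And.
apply/andP; split; first by apply/sat_bigAnd => i _; exact: root.
apply/sat_Box => y; rewrite (seen_fromE xA) => /orP[/eqP->|/existsP[i yi]];
  apply/sat_bigOr.
  (* The choice of [true] is arbitrary: at the root both diamonds hold. *)
  by exists true; [rewrite inE | exact: root].
by exists i; [rewrite inE | exact: self].
Qed.

(** The diamonds match every cluster of [d] with a seen one, and the box ensures that every seen
    cluster is matched. [B] is [A], relabelled if the matching is crossed. *)
Lemma sat_char_formula_matches d :
  sat R V x (char_formula d) ->
  d.1 \subset ltype x /\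
  exists B, sees_clusters R x B /\ forall i, matches (d.2 i) (B i).
Proof.
rewrite !sat_And sat_type_formula.
case/and3P=> -> /sat_bigAnd H1 /sat_Box H2; split=> //.
have tot i : exists j, matches (d.2 i) (A j).
  by apply: sat_root_Dia_cluster_formula; apply: H1; rewrite inE.
have surj j : exists i, matches (d.2 i) (A j).
  have /set0Pn[b bA] := seen_neq0 xA j.
  have /sat_bigOr[i _ H] := H2 b (sees_clusters_mem xA bA).
  by exists i; apply/(sat_Dia_cluster_formula _ bA).
(* A total surjective relation on [bool] contains the identity or the negation. *)
suff [H|H] : (forall i, matches (d.2 i) (A i)) \/ (forall i, matches (d.2 i) (A (~~ i))).
- by exists A.
- by exists (A \o negb); split=> //; exact: sees_clusters_swap.
have [[] m1] := tot true; have [[] m2] := tot false.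
- have [[] m3] := surj false; first by right=> -[].
  by left=> -[].
- by left=> -[].
- by right=> -[].
- have [[] m3] := surj true; first by left=> -[].
  by right=> -[].
Qed.

End Model.

Lemma ltype_subset (W W' : finType) (R : rel W) (R' : rel W') V V' x x' :
  ltype R V x \subset ltype R' V' x' ->
  (forall p, p \in Xpos -> V p x -> V' p x') /\
  (forall p, p \in Xneg -> V' p x' -> V p x).
Proof.
move/subsetP => H; split=> p pX.
  by have := H (inl [` pX]); rewrite !inE.
by have := H (inr [` pX]); rewrite !inE /= => h; apply: contraLR.
Qed.

End Characteristic.

(** * Amalgamation *)

Lemma amalgamation (phi psi : form) (Xpos Xneg : {fset nat})
    (M N : finType) (RM : rel M) (RN : rel N) VM VN x y A B :
  vpos phi `&` vpos psi `<=` Xpos -> vneg phi `&` vneg psi `<=` Xneg ->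
  sees_clusters RM x A -> sees_clusters RN y B ->
  ltype Xpos Xneg RM VM x \subset ltype Xpos Xneg RN VN y ->
  (forall i, matches RN VN (ltype Xpos Xneg RM VM @: A i) (B i)) ->
  sat RM VM x phi -> Gamma_LV_omega_1 (Imp phi psi) -> sat RN VN y psi.
Proof.
move=> Xp Xn xA yB sub_xy AB phix phipsi.
pose le m n := ltype Xpos Xneg RM VM m \subset ltype Xpos Xneg RN VN n.
pose E i := {e : M * N | [&& e.1 \in A i, e.2 \in B i & le e.1 e.2]}.
have En i : inhabited (E i).
  have /set0Pn[m mA] := seen_neq0 xA i.
  have [n nB mn] := (AB i).2 _ (imset_f _ mA).
  by constructor; exists (m, n); rewrite /= mA nB.
pose f i (e : E i) := (val e).1; pose g i (e : E i) := (val e).2.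
have fA i (e : E i) : f i e \in A i by case/and3P: (valP e).
have gB i (e : E i) : g i e \in B i by case/and3P: (valP e).
(* The second half of [matches] makes the projection to [A i] surjective, the first half the
   projection to [B i]. *)
have Af i m : m \in A i -> exists e : E i, f i e = m.
  move=> mA; have [n nB mn] := (AB i).2 _ (imset_f _ mA).
  have mnE : [&& (m, n).1 \in A i, (m, n).2 \in B i & le (m, n).1 (m, n).2].
    by rewrite /= mA nB.
  by exists (Sub (m, n) mnE).
have Bg i n : n \in B i -> exists e : E i, g i e = n.
  move=> nB; have [_ /imsetP[m mA ->] mn] := (AB i).1 _ nB.
  have mnE : [&& (m, n).1 \in A i, (m, n).2 \in B i & le (m, n).1 (m, n).2].
    by rewrite /= mA nB.
  by exists (Sub (m, n) mnE).
pose F := two_cluster_map f x; pose G := two_cluster_map g y.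
have leFG u : le (F u) (G u) by case: u => [[i e]|] //=; case/and3P: (valP e).
(* The least valuation to which truth lifts along [F] for positive variables of [phi] and along [G]
   for negative variables of [psi]. The bounds from above, by [VM] on [vneg phi] and by [VN] on
   [vpos psi], hold for shared variables by [leFG]. *)
pose U p u := (p \in vpos phi) && VM p (F u) || (p \in vneg psi) && VN p (G u).
have phiK : sat (@two_cluster_rel E) U None phi.
  apply: (@pmorphism_sat _ _ _ _ U VM F (vpos phi) (vneg phi)
    (two_cluster_map_homo xA fA) (two_cluster_map_lift xA fA Af)
    _ _ phi None).1 => // u p pphi; first by rewrite /U pphi => ->.
  case/orP=> /andP[ppsi] // /((ltype_subset (leFG u)).2 p); apply.
  by apply: (fsubsetP Xn); rewrite inE pphi.
have psiK : sat (@two_cluster_rel E) U None psi.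
  by have /implyP := phipsi _ _ (two_cluster_LV_frame En) U None; apply.
apply: (@pmorphism_sat _ _ _ _ U VN G (vneg psi) (vpos psi)
  (two_cluster_map_homo yB gB) (two_cluster_map_lift yB gB Bg)
  _ _ psi None).2 psiK => // u p ppsi; first by rewrite /U ppsi => ->; rewrite orbT.
case/orP=> /andP[pphi] // /((ltype_subset (leFG u)).1 p); apply.
by apply: (fsubsetP Xp); rewrite inE pphi.
Qed.

(** * The interpolant *)

Theorem theorem7p3 : uniform_Lyndon_interpolation Gamma_LV_omega_1.
Proof.
move=> phi Ppos Pneg.
pose Xpos := vpos phi `\` Ppos; pose Xneg := vneg phi `\` Pneg.
(* Infinitely many models realize only finitely many data, so the disjunction is finite; the
   realized data are selected classically. *)
pose realized (d : datum Xpos Xneg) := exists (W : finType) (R : rel W) V x A,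
  [/\ sees_clusters R x A, sat R V x phi & d = datum_of Xpos Xneg R V x A].
exists (bigOr [set d | `[< realized d >]] (@char_formula Xpos Xneg)).
split.
- move=> W R LVR V x; apply/implyP => phix.
  have [A xA] := LV_frame_sees_clusters x LVR.
  apply/sat_bigOr; exists (datum_of Xpos Xneg R V x A); last exact: sat_char_formula_of.
  by rewrite inE; apply/asboolP; exists W, R, V, x, A.
- by apply: vars_bigOr => d; exact: (vars_char_formula true).
- by apply: vars_bigOr => d; exact: (vars_char_formula false).
move=> psi phipsi psiP psiN N RN LVN VN y; apply/implyP.
case/sat_bigOr=> d; rewrite inE => /asboolP[M [RM] [VM] [x] [A] [xA phix ->]].
have [B0 yB0] := LV_frame_sees_clusters y LVN.
case/(sat_char_formula_matches yB0) => xy [B [yB AB]].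
(* As [psi] avoids the removed variables, those it shares with [phi] in a given polarity are
   available to the interpolant. *)
have IX (v w P : {fset nat}) : w `&` P = fset0 -> v `&` w `<=` v `\` P.
  move=> wP; apply/fsubsetP => p; rewrite !inE => /andP[-> pw]; rewrite andbT.
  by apply/negP => pP; have := in_fset0 p; rewrite -wP inE pw pP.
apply: (amalgamation (IX _ _ _ psiP) (IX _ _ _ psiN) xA yB xy _ phix phipsi) => i.
by have := AB i; rewrite ffunE.
Qed.
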